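(* Let $d=2$ (with $b=0$), or $d=3$ with $L_2+L_3=0$. Assume that the stabilizing parameter $\kappa$ satisfies $$\kappa\ge\max\Big\{a+c\big(\eta^{(d)}\big)^2,\ \max_{\xi\in[0,\eta^{(d)}]}|\overline f'(\xi)|\Big\}.$$ Then the MBP-sESAV1 scheme unconditionally preserves the maximum bound principle: for every $\tau>0$ and every mesh size $h$, the sequence $(Q_h^n,s^n)_{n\ge0}$ generated by $(Q_h^{n+1},s^{n+1})=\text{MBP-sESAV1}(Q_h^n,s^n,\tau)$ satisfies $$\|Q_h^n\|_{F,\infty}\le\eta^{(d)}\qquad\text{for all } n\ge0 .$$
   Context: Parameters: $a\in\mathbb R$, $b\ge0$, $c>0$, with $b=0$ if $d=2$; $L_1,L_2,L_3$ are the elastic constants and $L=L_1+\frac{L_2+L_3}{2}>0$ (so $L=L_1$ in the case $d=3$, $L_2+L_3=0$). Domain $\Omega=[0,L_d]^d$, mesh size $h=L_d/M$ with $M$ a positive integer, uniform grid with nodes $\{0,\dots,M\}^d$. Grid functions. $\mathbf E_h^0$ is the set of real functions on the grid vanishing at all boundary nodes (homogeneous Dirichlet). $\mathbf S_h^{(d)}$ is the set of symmetric trace-free $d\times d$ arrays with entries in $\mathbf E_h^0$. $\Delta_h$ is the standard $(2d+1)$-point discrete Laplacian, $\langle U,V\rangle_h=h^d\sum U V$ (sum over grid nodes), and $\|\nabla_hQ_h\|_h^2=-\sum_{i,j}\langle\Delta_hQ_h^{ij},Q_h^{ij}\rangle_h$. $\|Q_h\|_{F,\infty}$ is the maximum over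 grid nodes of the Frobenius norm of the matrix $Q_h$ at that node. Initial data. $Q^0:\overline\Omega\to\mathbb R^{d\times d}$ is symmetric and trace-free and vanishes on $\partial\Omega$; $\|Q^0\|_{L^\infty(\Omega)}=\sup_{x\in\Omega}|Q^0(x)|_F$ with $|\cdot|_F$ the Frobenius norm. $Q_h^0$ is the restriction of $Q^0$ to the grid, and $s^0=\mathcal E_{1h}[Q_h^0]$. Bounds. With $a_-=\max\{0,-a\}$, $$\eta^{(2)}=\max\Big\{\|Q^0\|_{L^\infty(\Omega)},\sqrt{a_-/c}\Big\},$$ $$\eta^{(3)}=\max\Big\{\|Q^0\|_{L^\infty(\Omega)},\frac{|b|+\sqrt{b^2-24ac}}{2\sqrt6\,c}\Big\}\ \text{if } a\le\frac{b^2}{24c},\qquad \eta^{(3)}=\|Q^0\|_{L^\infty(\Omega)}\ \text{otherwise.}$$ $\overline f(\xi)=-a\xi+\frac{b}{\sqrt6}\xi^2-c\xi^3$. Nonlinearity (at each node): $f(Q^{ij})=-aQ^{ij}+b\big((Q^2)^{ij}-\frac1d\operatorname{tr}(Q^2)\delta^{ij}\big)-c\operatorname{tr}(Q^2)Q^{ij}$. With $\mathcal F_{\rm bulk}(Q)=\frac a2\operatorname{tr}(Q^2)-\frac b3\operatorname{tr}(Q^3)+\frac c4\operatorname{tr}^2(Q^2)$, $\mathcal E_{1h}[Q_h]=\langle\mathcal F_{\rm bulk}(Q_h),1\rangle_h$ and $g(Q_h,s)=\exp\{s\}/\exp\{\mathcal E_{1h}[Q_h]\}$. $C_*>0$ is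 a fixed constant with $|\Omega|\mathcal F_{\rm bulk}(A)\ge-C_*$ for all symmetric trace-free $A\in\mathbb R^{d\times d}$; $E_{el}[Q_h]=\frac L2\|\nabla_hQ_h\|_h^2$. Scheme. $(Q_h^{n+1},s^{n+1})=\text{MBP-sESAV1}(Q_h^n,s^n,\tau)\in\mathbf S_h^{(d)}\times\mathbb R$ is defined by, for $1\le i,j\le d$ at all interior nodes, $$\frac{Q_h^{ij,n+1}-Q_h^{ij,n}}{\tau}=L\Delta_hQ_h^{ij,n+1}+g(Q_h^n,s^n)\big(f(Q_h^{ij,n})-\kappa(Q_h^{ij,n+1}-Q_h^{ij,n})\big),$$ $$\tilde s^{n+1}=s^n-g(Q_h^n,s^n)\sum_{i,j=1}^d\langle f(Q_h^{ij,n}),Q_h^{ij,n+1}-Q_h^{ij,n}\rangle_h,\qquad s^{n+1}=\max\{\tilde s^{n+1},-C_*-E_{el}[Q_h^{n+1}]\}.$$ *)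

(* Defs.v *)
From HB Require Import structures.
From mathcomp Require Import all_boot all_order all_algebra.
From mathcomp Require Import all_classical all_reals all_analysis.

Set Implicit Arguments.
Unset Strict Implicit.
Unset Printing Implicit Defensive.

Import Order.TTheory GRing.Theory Num.Theory.
Import numFieldNormedType.Exports.
Local Open Scope classical_set_scope.
Local Open Scope ring_scope.

Definition grid (d M : nat) := {ffun 'I_d -> 'I_M.+1}.

Definition interior_node d M (x : grid d M) : bool :=
  [forall k, (0 < x k < M)%N].

Definition grid_point (R : realType) d M (h : R) (x : grid d M) : 'rV[R]_d :=
  \row_k (h * (x k)%:R).

(* Neighbours of a node along axis k; [inord] only returns the intended index
   when it lies in {0, ..., M}, which holds at interior nodes. *)
Definition node_next d M (k : 'I_d) (x : grid d M) : grid d M :=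
  [ffun l => if l == k then inord (x l).+1 else x l].

Definition node_prev d M (k : 'I_d) (x : grid d M) : grid d M :=
  [ffun l => if l == k then inord (x l).-1 else x l].

(* The value 0 at boundary nodes is a convention: the Laplacian is only
   evaluated at interior nodes or paired with functions vanishing on the
   boundary. *)
Definition laplace_h (R : realType) d M (h : R) (U : grid d M -> R)
    (x : grid d M) : R :=
  if interior_node x then
    \sum_(k < d) (U (node_next k x) - 2 * U x + U (node_prev k x)) / h ^+ 2
  else 0.

Definition inner_h (R : realType) d M (h : R) (U V : grid d M -> R) : R :=
  h ^+ d * \sum_(x : grid d M) U x * V x.

Definition sym_tracefree (R : realType) d (A : 'M[R]_d) : Prop :=
  A^T = A /\ \tr A = 0.

(* An element of S_h^(d) is encoded as a matrix-valued grid function. *)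
Definition in_Sh (R : realType) d M (Q : grid d M -> 'M[R]_d) : Prop :=
  (forall x, sym_tracefree (Q x)) /\
  (forall x, ~~ interior_node x -> Q x = 0).

Definition frob (R : realType) d (A : 'M[R]_d) : R :=
  Num.sqrt (\sum_i \sum_j A i j ^+ 2).

Definition norm_Finf (R : realType) d M (Q : grid d M -> 'M[R]_d) : R :=
  \big[Num.max/0]_(x : grid d M) frob (Q x).

Definition grad_norm2 (R : realType) d M (h : R) (Q : grid d M -> 'M[R]_d) : R :=
  - \sum_(i < d) \sum_(j < d)
      inner_h h (laplace_h h (fun x => Q x i j)) (fun x => Q x i j).

Definition E_el (R : realType) d M (L h : R) (Q : grid d M -> 'M[R]_d) : R :=
  L / 2 * grad_norm2 h Q.

Definition F_bulk (R : realType) d (a b c : R) (A : 'M[R]_d) : R :=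
  a / 2 * \tr (A *m A) - b / 3 * \tr (A *m A *m A)
  + c / 4 * (\tr (A *m A)) ^+ 2.

Definition f_bulk (R : realType) d (a b c : R) (A : 'M[R]_d) : 'M[R]_d :=
  - a *: A + b *: (A *m A - (d%:R^-1 * \tr (A *m A))%:M)
  - (c * \tr (A *m A)) *: A.

Definition E_1h (R : realType) d M (a b c h : R) (Q : grid d M -> 'M[R]_d) : R :=
  inner_h h (fun x => F_bulk a b c (Q x)) (fun=> 1).

Definition g_h (R : realType) d M (a b c h : R) (Q : grid d M -> 'M[R]_d)
    (s : R) : R :=
  expR s / expR (E_1h a b c h Q).

Definition mbp_sesav1 (R : realType) d M (a b c L kappa Cstar h tau : R)
    (Q : grid d M -> 'M[R]_d) (s : R)
    (Q' : grid d M -> 'M[R]_d) (s' : R) : Prop :=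
  let g := g_h a b c h Q s in
  let s_tilde := s - g * \sum_(i < d) \sum_(j < d)
    inner_h h (fun x => f_bulk a b c (Q x) i j)
              (fun x => Q' x i j - Q x i j) in
  [/\ in_Sh Q',
      (forall x, interior_node x -> forall i j,
         (Q' x i j - Q x i j) / tau
         = L * laplace_h h (fun y => Q' y i j) x
           + g * (f_bulk a b c (Q x) i j - kappa * (Q' x i j - Q x i j)))
    & s' = Num.max s_tilde (- Cstar - E_el L h Q')].

Definition cube (R : realType) d (Ld : R) : set 'rV[R]_d :=
  [set x | forall k, 0 <= x ord0 k <= Ld].

Definition cube_boundary (R : realType) d (Ld : R) : set 'rV[R]_d :=
  [set x | cube Ld x /\ exists k, x ord0 k = 0 \/ x ord0 k = Ld].

(* [sup] is only meaningful when the set of values is bounded above. *)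
Definition sup_norm (R : realType) d (Ld : R) (Q0 : 'rV[R]_d -> 'M[R]_d) : R :=
  sup [set frob (Q0 x) | x in cube Ld].

Definition eta2 (R : realType) (a c q0 : R) : R :=
  Num.max q0 (Num.sqrt (Num.max 0 (- a) / c)).

Definition eta3 (R : realType) (a b c q0 : R) : R :=
  if a <= b ^+ 2 / (24 * c) then
    Num.max q0
      ((`|b| + Num.sqrt (b ^+ 2 - 24 * a * c)) / (2 * Num.sqrt 6 * c))
  else q0.

(* q0 stands for the sup norm of the initial datum; only d = 2, 3 occur. *)
Definition eta_bound (R : realType) (d : nat) (a b c q0 : R) : R :=
  if d == 2%N then eta2 a c q0 else eta3 a b c q0.

Definition fbar (R : realType) (a b c xi : R) : R :=
  - a * xi + b / Num.sqrt 6 * xi ^+ 2 - c * xi ^+ 3.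

(* Main.v *)
Require Import Defs.
From HB Require Import structures.
From mathcomp Require Import all_boot all_order all_algebra.
From mathcomp Require Import all_classical all_reals all_analysis.
From mathcomp Require Import ring lra.

(** Each time step is an implicit heat step with a stabilized explicit source:
    (1/tau + g kappa) Q' - L Lap_h Q' = Q / tau + g (kappa Q + f(Q)),  g > 0.
    Two facts propagate the bound |Q| <= eta from one time level to the next.

    The first is a maximum principle for the Frobenius norm
    ([implicit_step_bound]).  At a node where |Q'| is largest, the inner product
    of Lap_h Q' with Q' is nonpositive by Cauchy-Schwarz ([laplace_h_max]).
    Pairing the equation with Q' at that node bounds (1/tau + g kappa) |Q'| by the
    norm of the right-hand side.  The auxiliary variable s enters only through g,
    and any nonnegative value of g is harmless.

    The second is a pointwise bound, |kappa A + f(A)| <= kappa eta whenever A is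
    symmetric and trace-free with |A| <= eta.  Since kappa >= a + c eta^2, the
    triangle inequality gives |kappa A + f(A)| <= kappa r + fbar r with r = |A|
    ([frob_stabilized_le]); the quadratic term is absorbed because
    |A^2 - tr(A^2)/3| = |A|^2 / sqrt 6 in dimension three ([frob_deviator3]),
    while b = 0 in dimension two.  Since kappa >= |fbar'| on [0, eta], the function
    kappa r + fbar r is nondecreasing there ([fbar_stabilized_mono]).  Its value at
    eta is at most kappa eta, because eta lies beyond the largest zero of fbar
    ([fbar_eta2_le0], [fbar_eta3_le0]). *)

Set Implicit Arguments.
Unset Strict Implicit.
Unset Printing Implicit Defensive.

Import Order.TTheory GRing.Theory Num.Theory.
Import numFieldNormedType.Exports.
Local Open Scope classical_set_scope.
Local Open Scope ring_scope.

(** * The Frobenius inner product *)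

Definition fdot (R : realType) d (A B : 'M[R]_d) : R :=
  \sum_i \sum_j A i j * B i j.

Lemma fdotDl (R : realType) d (A B C : 'M[R]_d) :
  fdot (A + B) C = fdot A C + fdot B C.
Proof.
rewrite /fdot -big_split; apply: eq_bigr => i _.
by rewrite -big_split; apply: eq_bigr => j _; rewrite mxE mulrDl.
Qed.

Lemma fdotZl (R : realType) d (k : R) (A B : 'M[R]_d) :
  fdot (k *: A) B = k * fdot A B.
Proof.
rewrite /fdot mulr_sumr; apply: eq_bigr => i _.
by rewrite mulr_sumr; apply: eq_bigr => j _; rewrite mxE mulrA.
Qed.

Lemma fdotC (R : realType) d (A B : 'M[R]_d) : fdot A B = fdot B A.
Proof. by apply: eq_bigr => i _; apply: eq_bigr => j _; rewrite mulrC. Qed.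

Lemma fdotDr (R : realType) d (A B C : 'M[R]_d) :
  fdot C (A + B) = fdot C A + fdot C B.
Proof. by rewrite fdotC fdotDl !(fdotC C). Qed.

Lemma fdotZr (R : realType) d (k : R) (A B : 'M[R]_d) :
  fdot B (k *: A) = k * fdot B A.
Proof. by rewrite fdotC fdotZl fdotC. Qed.

Lemma fdot_ge0 (R : realType) d (A : 'M[R]_d) : 0 <= fdot A A.
Proof. by apply: sumr_ge0 => i _; apply: sumr_ge0 => j _; rewrite -expr2 sqr_ge0. Qed.

Lemma fdot_sum_l (R : realType) d (I : finType) (F : I -> 'M[R]_d)
    (B : 'M[R]_d) :
  fdot (\sum_k F k) B = \sum_k fdot (F k) B.
Proof.
apply: (big_morph (fun A => fdot A B)) => [A C|]; first exact: fdotDl.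
by rewrite -(scale0r 0) fdotZl mul0r.
Qed.

Lemma frobE (R : realType) d (A : 'M[R]_d) : frob A = Num.sqrt (fdot A A).
Proof.
by congr Num.sqrt; apply: eq_bigr => i _; apply: eq_bigr => j _; rewrite expr2.
Qed.

Lemma frob_ge0 (R : realType) d (A : 'M[R]_d) : 0 <= frob A.
Proof. exact: sqrtr_ge0. Qed.

Lemma sqr_frob (R : realType) d (A : 'M[R]_d) : frob A ^+ 2 = fdot A A.
Proof. by rewrite frobE sqr_sqrtr // fdot_ge0. Qed.

Lemma frob_le_sqr (R : realType) d (A : 'M[R]_d) (r : R) :
  0 <= r -> (frob A <= r) = (fdot A A <= r ^+ 2).
Proof.
by move=> r0; rewrite -sqr_frob ler_pXn2r // nnegrE // frob_ge0.
Qed.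

Lemma frob0_eq0 (R : realType) d (A : 'M[R]_d) : frob A = 0 -> A = 0.
Proof.
move=> A0; have := sqr_frob A; rewrite A0 expr0n /= => /esym/eqP.
rewrite psumr_eq0 => [/allP AP|i _]; last first.
  by apply: sumr_ge0 => j _; rewrite -expr2 sqr_ge0.
apply/matrixP => i j; rewrite mxE; apply/eqP; rewrite -sqrf_eq0 expr2.
have := AP i (mem_index_enum i); rewrite psumr_eq0 => [/allP/(_ j)|k _].
  by apply; exact: mem_index_enum.
by rewrite -expr2 sqr_ge0.
Qed.

Lemma frob0 (R : realType) d : frob (0 : 'M[R]_d) = 0.
Proof. by rewrite frobE -(scale0r 0) fdotZl mul0r sqrtr0. Qed.

Lemma fdot_le_frob (R : realType) d (A B : 'M[R]_d) :
  fdot A B <= frob A * frob B.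
Proof.
have [/frob0_eq0 ->|nA] := eqVneq (frob A) 0.
  by rewrite -{1}(scale0r 0) fdotZl frob0 !mul0r.
have [/frob0_eq0 ->|nB] := eqVneq (frob B) 0.
  by rewrite -{1}(scale0r 0) fdotZr frob0 mul0r mulr0.
have pA : 0 < frob A by rewrite lt_neqAle eq_sym nA frob_ge0.
have pB : 0 < frob B by rewrite lt_neqAle eq_sym nB frob_ge0.
have := fdot_ge0 (frob B *: A + (- frob A) *: B).
rewrite !(fdotDl, fdotDr, fdotZl, fdotZr) -!sqr_frob (fdotC B A) => H.
rewrite -(ler_pM2l (mulr_gt0 pA pB)); lra.
Qed.

Lemma frobD (R : realType) d (A B : 'M[R]_d) : frob (A + B) <= frob A + frob B.
Proof.
rewrite frob_le_sqr ?addr_ge0 ?frob_ge0 //.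
rewrite !(fdotDl, fdotDr) (fdotC B A) -!sqr_frob.
have := fdot_le_frob A B; lra.
Qed.

Lemma frobZ (R : realType) d (k : R) (A : 'M[R]_d) :
  0 <= k -> frob (k *: A) = k * frob A.
Proof.
by move=> k0; rewrite !frobE fdotZl fdotZr mulrA -expr2 sqrtrM ?sqr_ge0 //
  sqrtr_sqr ger0_norm.
Qed.

Lemma tr_sqr_sym (R : realType) d (A : 'M[R]_d) :
  A^T = A -> \tr (A *m A) = frob A ^+ 2.
Proof.
move=> AT; rewrite sqr_frob; apply: eq_bigr => i _; rewrite mxE.
by apply: eq_bigr => j _; rewrite -{2}AT mxE.
Qed.

(** * The bulk force on symmetric trace-free matrices *)

(** By Cayley-Hamilton a trace-free 3 x 3 matrix satisfies
    tr A^4 = (tr A^2)^2 / 2, so the squared norm of the trace-free part of A^2,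
    namely tr A^4 - (tr A^2)^2 / 3, is |A|^4 / 6.  This is where dimension three
    and the constant sqrt 6 of [fbar] enter. *)
Lemma frob_deviator3 (R : realType) (A : 'M[R]_3) : sym_tracefree A ->
  frob (A *m A - (3%:R^-1 * \tr (A *m A))%:M) = frob A ^+ 2 / Num.sqrt 6.
Proof.
move=> [AT trA]; rewrite tr_sqr_sym // [LHS]frobE.
rewrite -[RHS]ger0_norm ?divr_ge0 ?sqr_ge0 ?sqrtr_ge0 // -sqrtr_sqr.
congr Num.sqrt; rewrite exprMn exprVn (@sqr_sqrtr _ 6) // !sqr_frob.
have E i j : A i j = A j i by rewrite -{1}AT mxE.
move: trA; rewrite /mxtrace /fdot !big_ord_recl !big_ord0 !mxE /=.
rewrite !big_ord_recl !big_ord0 /=.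
rewrite !(E (lift ord0 ord0) ord0) !(E (lift ord0 (lift ord0 ord0)) _).
(* Six entries remain; eliminating a00 through the trace turns the claim into a
   polynomial identity in the other five. *)
move: (A _ _) (A _ _) (A _ _) (A _ _) (A _ _) (A _ _) => a12 a02 a01 a22 a11 a00 tr0.
have {tr0}-> : a00 = - (a11 + a22) by lra.
by field.
Qed.

Lemma derive1_fbar (R : realType) (a b c x : R) :
  derive1 (fbar a b c) x = - a + 2 * (b / Num.sqrt 6) * x - 3 * c * x ^+ 2.
Proof.
pose p := 'X * (- a)%:P + (b / Num.sqrt 6)%:P * 'X ^+ 2 - c%:P * 'X^3.
have -> : fbar a b c = horner p.
  by apply/funext => y; rewrite /fbar /p !hornerE; ring.
rewrite derive1E (@derive_val _ _ _ _ _ _ _ (is_derive_poly p x)) /p.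
rewrite !(derivB, derivD, derivM, derivC, derivXn, derivX) !hornerE /=.
by ring.
Qed.

(** Passing from the supremum to a pointwise bound requires the values of
    |fbar'| to be bounded above on the interval, since [sup] is a junk value
    otherwise; the coefficientwise bound on the quadratic fbar' supplies this. *)
Lemma derive1_fbar_le (R : realType) (a b c kappa eta x : R) :
  sup [set `|derive1 (fbar a b c) xi| | xi in `[0, eta]] <= kappa ->
  0 <= x <= eta -> `|derive1 (fbar a b c) x| <= kappa.
Proof.
move=> hk x0e; apply: le_trans hk; apply: ub_le_sup; last first.
  by exists x => //; rewrite /= in_itv.
exists (`|a| + 2 * `|b / Num.sqrt 6| * eta + 3 * `|c| * eta ^+ 2) => _ [y + <-].
rewrite /= in_itv /= => /andP[y0 ye]; rewrite derive1_fbar.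
rewrite (le_trans (ler_normB _ _))// lerD//.
  rewrite (le_trans (ler_normD _ _))// normrN lerD// 2!normrM.
  by rewrite !(ger0_norm y0) (ger0_norm (ler0n _ 2)) ler_wpM2l// mulr_ge0.
rewrite 2!normrM (ger0_norm (ler0n _ 3)) ler_wpM2l ?mulr_ge0// normrX.
by rewrite ger0_norm// ler_pXn2r// nnegrE// (le_trans y0).
Qed.

(** The stabilization is chosen so that kappa x + fbar x has a nonnegative
    derivative.  As fbar' is quadratic, Simpson's rule integrates it exactly,
    which expresses the increment as a positive combination of three values of
    that derivative and avoids a mean value argument. *)
Lemma fbar_stabilized_mono (R : realType) (a b c kappa eta r : R) :
  (forall x, 0 <= x <= eta -> `|derive1 (fbar a b c) x| <= kappa) ->
  0 <= r <= eta ->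
  kappa * r + fbar a b c r <= kappa * eta + fbar a b c eta.
Proof.
move=> hk /andP[r0 re].
pose F x := kappa + (- a + 2 * (b / Num.sqrt 6) * x - 3 * c * x ^+ 2).
have F0 x : 0 <= x -> x <= eta -> 0 <= F x.
  move=> x0 xe; have := hk x; rewrite x0 xe /F -derive1_fbar => /(_ isT).
  by rewrite ler_norml => /andP[]; lra.
have Fr := F0 _ r0 re; have Fe := F0 _ (le_trans r0 re) (lexx _).
have Fm : 0 <= F ((r + eta) / 2) by apply: F0; lra.
rewrite -subr_ge0.
have -> : kappa * eta + fbar a b c eta - (kappa * r + fbar a b c r)
    = (eta - r) / 6 * (F r + 4 * F ((r + eta) / 2) + F eta).
  by rewrite /F /fbar; field.
rewrite mulr_ge0 ?divr_ge0 ?subr_ge0//.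
by apply: addr_ge0 Fe; apply: addr_ge0 Fr _; exact: mulr_ge0.
Qed.

(** Writing kappa A + f(A) = (kappa - a - c |A|^2) A + b (A^2 - tr(A^2)/d), the
    condition on kappa makes the first coefficient nonnegative, so the triangle
    inequality loses nothing but the angle between the two terms and produces
    exactly the scalar function kappa r + fbar r.  The last hypothesis carries
    the factor b so that it covers both b = 0 in dimension two and
    [frob_deviator3] in dimension three. *)
Lemma frob_stabilized_le (R : realType) d (a b c kappa : R) (A : 'M[R]_d) :
  sym_tracefree A -> 0 <= b -> a + c * frob A ^+ 2 <= kappa ->
  b * frob (A *m A - (d%:R^-1 * \tr (A *m A))%:M)
    <= b * (frob A ^+ 2 / Num.sqrt 6) ->
  frob (kappa *: A + f_bulk a b c A) <= kappa * frob A + fbar a b c (frob A).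
Proof.
move=> [AT _] b0 hk hdev.
have -> : kappa *: A + f_bulk a b c A =
    (kappa - a - c * frob A ^+ 2) *: A
    + b *: (A *m A - (d%:R^-1 * \tr (A *m A))%:M).
  rewrite /f_bulk (tr_sqr_sym AT); set D := _ - _.
  by apply/matrixP => i j; rewrite !mxE; ring.
apply: le_trans (frobD _ _) _; rewrite !frobZ //; last by lra.
have -> : kappa * frob A + fbar a b c (frob A) =
    (kappa - a - c * frob A ^+ 2) * frob A
    + b * (frob A ^+ 2 / Num.sqrt 6) by rewrite /fbar; ring.
by rewrite lerD2l.
Qed.

(** The threshold sqrt (a_- / c) is the largest zero of fbar when b = 0, and
    fbar is nonpositive beyond it. *)
Lemma fbar_eta2_le0 (R : realType) (a c q0 : R) :
  0 < c -> fbar a 0 c (eta2 a c q0) <= 0.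
Proof.
move=> c0; rewrite /eta2; set e := Num.max _ _.
have w0 : 0 <= Num.max 0 (- a) / c by rewrite divr_ge0 ?le_max ?lexx// ltW.
have e0 : 0 <= e by rewrite le_max sqrtr_ge0 orbT.
have h : Num.max 0 (- a) <= c * e ^+ 2.
  rewrite mulrC -ler_pdivrMr// -(sqr_sqrtr w0) ler_pXn2r ?nnegrE ?sqrtr_ge0//.
  by rewrite le_max lexx orbT.
have {}h : 0 <= a + c * e ^+ 2.
  rewrite -lerBlDl sub0r; apply: le_trans h; by rewrite le_max lexx orbT.
have -> : fbar a 0 c e = - (e * (a + c * e ^+ 2)) by rewrite /fbar; ring.
by rewrite oppr_le0 mulr_ge0.
Qed.

(** When b^2 - 24 a c >= 0 the explicit threshold in [eta3] is the largest root
    of the quadratic - a + (b / sqrt 6) x - c x^2 = fbar x / x; otherwise this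
    quadratic has no real root and is negative everywhere. *)
Lemma fbar_eta3_le0 (R : realType) (a b c q0 : R) :
  0 <= b -> 0 < c -> 0 <= q0 -> fbar a b c (eta3 a b c q0) <= 0.
Proof.
move=> b0 c0 q00.
pose s6 : R := Num.sqrt 6; have s6p : 0 < s6 by rewrite sqrtr_gt0.
have s62 : s6 ^+ 2 = 6 by rewrite sqr_sqrtr.
(* Completing the square in fbar x / x. *)
have factor x : fbar a b c x =
    - (x / (4 * c) * ((2 * c * x - b / s6) ^+ 2 - (b ^+ 2 - 24 * a * c) / 6)).
  rewrite /fbar -/s6 -s62.
  have -> : 24 = 4 * s6 ^+ 2 by rewrite s62; ring.
  by field; rewrite !gt_eqF.
rewrite factor oppr_le0 /eta3; case: ifPn => [hle|].
  set disc := Num.sqrt (_ - _); set root := (_ + disc) / _; set e := Num.max _ _.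
  have D0 : 0 <= b ^+ 2 - 24 * a * c.
    by move: hle; rewrite ler_pdivlMr ?mulr_gt0// => hle; lra.
  have root0 : 0 <= root.
    apply: divr_ge0; first by rewrite addr_ge0 ?sqrtr_ge0.
    by rewrite mulr_ge0 ?(ltW c0)// mulr_ge0 ?sqrtr_ge0.
  have re : root <= e by rewrite le_max lexx orbT.
  have e0 : 0 <= e := le_trans root0 re.
  apply: mulr_ge0; first by rewrite divr_ge0// mulr_ge0// ltW.
  rewrite subr_ge0.
  have -> : (b ^+ 2 - 24 * a * c) / 6 = (disc / s6) ^+ 2.
    by rewrite exprMn exprVn s62 sqr_sqrtr.
  have rootE : disc / s6 = 2 * c * root - b / s6.
    by rewrite /root (ger0_norm b0) -/s6; field; rewrite !gt_eqF.
  have : disc / s6 <= 2 * c * e - b / s6.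
    by rewrite rootE lerD2r ler_wpM2l// mulr_ge0// ltW.
  have : 0 <= disc / s6 by rewrite divr_ge0 ?sqrtr_ge0// ltW.
  by move=> p q; rewrite ler_pXn2r// nnegrE// (le_trans p).
rewrite -ltNge ltr_pdivrMr ?mulr_gt0// => hlt.
apply: mulr_ge0; first by rewrite divr_ge0// mulr_ge0// ltW.
have := sqr_ge0 (2 * c * q0 - b / s6); lra.
Qed.

(** * Maximum principle for the implicit step *)

(** At a node where |U| is largest, Cauchy-Schwarz gives
    <U(y), U(x)> <= |U(x)|^2 for every neighbour y.  Hence the Laplacian of the
    matrix field points inwards there, although no single entry of U need be
    extremal. *)
Lemma laplace_h_max (R : realType) d M (h : R) (U : grid d M -> 'M[R]_d) x :
  (forall y, frob (U y) <= frob (U x)) ->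
  fdot (\matrix_(i, j) laplace_h h (fun y => U y i j) x) (U x) <= 0.
Proof.
move=> xmax; rewrite /laplace_h; case: (interior_node x); last first.
  by apply: sumr_le0 => i _; apply: sumr_le0 => j _; rewrite mxE mul0r.
have -> : (\matrix_(i, j) \sum_(k < d)
    (U (node_next k x) i j - 2 * U x i j + U (node_prev k x) i j) / h ^+ 2) =
   \sum_(k < d) (h ^+ 2)^-1 *:
     (U (node_next k x) + (- 2) *: U x + U (node_prev k x)).
  apply/matrixP => i j; rewrite mxE summxE; apply: eq_bigr => k _.
  by rewrite !mxE mulNr mulrC.
rewrite fdot_sum_l; apply: sumr_le0 => k _.
rewrite fdotZl !fdotDl fdotZl mulr_ge0_le0 ?invr_ge0 ?sqr_ge0//.
have le_self y : fdot (U y) (U x) <= fdot (U x) (U x).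
  rewrite (le_trans (fdot_le_frob _ _))// -sqr_frob expr2.
  by rewrite ler_wpM2r ?frob_ge0.
have := le_self (node_next k x); have := le_self (node_prev k x); lra.
Qed.

(** Collecting the unknowns, the step reads
    (1/tau + g kappa) Q' - L Lap Q' = Q / tau + g (kappa Q + N).
    Pairing with Q' at a node where |Q'| is largest discards the Laplacian, and
    the right-hand side has norm at most (1/tau + g kappa) eta; the common factor
    cancels, so neither tau nor the mesh size is constrained. *)
Lemma implicit_step_bound (R : realType) d M (L h tau g kappa eta : R)
    (Q Q' N : grid d M -> 'M[R]_d) :
  0 <= L -> 0 < tau -> 0 <= g -> 0 <= kappa -> 0 <= eta ->
  (forall x, ~~ interior_node x -> Q' x = 0) ->
  (forall x, interior_node x -> forall i j,
     (Q' x i j - Q x i j) / tau = L * laplace_h h (fun y => Q' y i j) x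
       + g * (N x i j - kappa * (Q' x i j - Q x i j))) ->
  (forall x, frob (Q x) <= eta) ->
  (forall x, frob (kappa *: Q x + N x) <= kappa * eta) ->
  forall x, frob (Q' x) <= eta.
Proof.
move=> L0 tau0 g0 k0 eta0 bd step Qle Nle x1.
have [x _ xmax] := @arg_maxP _ R _ x1 predT (fun y => frob (Q' y)) isT.
apply: le_trans (xmax x1 isT) _.
have [ix|/bd ->] := boolP (interior_node x); last by rewrite frob0.
set D := \matrix_(i, j) laplace_h h (fun y => Q' y i j) x.
have eqn : (tau^-1 + g * kappa) *: Q' x =
    tau^-1 *: Q x + g *: (kappa *: Q x + N x) + L *: D.
  by apply/matrixP => i j; have := step x ix i j; rewrite !mxE => H; lra.
have D0 : L * fdot D (Q' x) <= 0.
  by rewrite mulr_ge0_le0// laplace_h_max// => y; exact: xmax.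
have lam0 : 0 < tau^-1 + g * kappa by rewrite ltr_wpDr ?mulr_ge0// invr_gt0.
have CS A e : frob A <= e -> fdot A (Q' x) <= e * frob (Q' x).
  by move=> Ae; rewrite (le_trans (fdot_le_frob _ _))// ler_wpM2r ?frob_ge0.
have : (tau^-1 + g * kappa) * frob (Q' x) ^+ 2 <=
       (tau^-1 + g * kappa) * (eta * frob (Q' x)).
  rewrite {1}sqr_frob -fdotZl eqn !fdotDl !fdotZl.
  have p1 : tau^-1 * fdot (Q x) (Q' x) <= tau^-1 * (eta * frob (Q' x)).
    by rewrite ler_wpM2l ?CS// invr_ge0 ltW.
  have := ler_wpM2l g0 (CS _ _ (Nle x)); lra.
rewrite ler_pM2l// expr2.
have [->//|n0] := eqVneq (frob (Q' x)) 0.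
by rewrite ler_pM2r// lt_neqAle eq_sym n0 frob_ge0.
Qed.

(** * The maximum bound principle *)

Theorem theorem3p3 (R : realType) (d : nat) (a b c L1 L2 L3 L : R)
  (Ld Cstar kappa tau : R) (M : nat)
  (Q0 : 'rV[R]_d -> 'M[R]_d)
  (Q : nat -> grid d M -> 'M[R]_d) (s : nat -> R)
  (hd : (d = 2%N /\ b = 0) \/ (d = 3%N /\ L2 + L3 = 0))
  (hb : 0 <= b) (hc : 0 < c)
  (hL : L = L1 + (L2 + L3) / 2) (hLpos : 0 < L)
  (hLd : 0 < Ld) (hM : (0 < M)%N) (htau : 0 < tau)
  (hCstar : 0 < Cstar)
  (hbulk : forall A : 'M[R]_d, sym_tracefree A ->
     - Cstar <= Ld ^+ d * F_bulk a b c A)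
  (hQ0 : forall x, cube Ld x -> sym_tracefree (Q0 x))
  (hQ0bd : forall x, cube_boundary Ld x -> Q0 x = 0)
  (hQ0bounded : has_ubound [set frob (Q0 x) | x in cube Ld])
  (hkappa :
     let etad := eta_bound d a b c (sup_norm Ld Q0) in
     Num.max (a + c * etad ^+ 2)
       (sup [set `|derive1 (fbar a b c) xi| | xi in `[0, etad]]) <= kappa)
  (hinitQ : forall x, Q 0%N x = Q0 (grid_point (Ld / M%:R) x))
  (hinits : s 0%N = E_1h a b c (Ld / M%:R) (Q 0%N))
  (hstep : forall n, mbp_sesav1 a b c L kappa Cstar (Ld / M%:R) tau
     (Q n) (s n) (Q n.+1) (s n.+1)) :
  forall n, norm_Finf (Q n) <= eta_bound d a b c (sup_norm Ld Q0).
Proof.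
move: hkappa; set q0 := sup_norm Ld Q0; set eta := eta_bound d a b c q0.
rewrite /= ge_max => /andP[hk1 hk2].
have in_cube (x : grid d M) : cube Ld (grid_point (Ld / M%:R) x).
  have Mp : 0 < M%:R :> R by rewrite ltr0n.
  move=> k; rewrite mxE mulr_ge0 ?divr_ge0 ?(ltW hLd)//=.
  by rewrite mulrAC ler_pdivrMr// ler_wpM2l ?(ltW hLd)// ler_nat -ltnS.
have le_q0 y : cube Ld y -> frob (Q0 y) <= q0.
  by move=> cy; apply: ub_le_sup => //; exists y.
have q00 : 0 <= q0.
  apply: le_trans (frob_ge0 (Q0 0)) (le_q0 0 _) => k.
  by rewrite mxE lexx ltW.
have q0eta : q0 <= eta.
  rewrite /eta /eta_bound /eta2 /eta3; case: ifP => _; first by rewrite le_max lexx.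
  by case: ifP => _; rewrite ?le_max ?lexx.
have eta0 : 0 <= eta := le_trans q00 q0eta.
have fbar_eta : fbar a b c eta <= 0.
  rewrite /eta /eta_bound; case: hd => -[-> hd2] /=; last exact: fbar_eta3_le0.
  by rewrite hd2; exact: fbar_eta2_le0.
have k0 : 0 <= kappa.
  apply: le_trans (normr_ge0 _) (derive1_fbar_le hk2 (x := 0) _).
  by rewrite lexx.
have dev (A : 'M[R]_d) : sym_tracefree A ->
    b * frob (A *m A - (d%:R^-1 * \tr (A *m A))%:M)
    <= b * (frob A ^+ 2 / Num.sqrt 6).
  case: hd => -[dE hd2]; first by rewrite hd2 !mul0r.
  by move: A; rewrite dE => A /frob_deviator3 ->.
have stab (A : 'M[R]_d) : sym_tracefree A -> frob A <= eta ->
    frob (kappa *: A + f_bulk a b c A) <= kappa * eta.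
  move=> sA Ae; have re : 0 <= frob A <= eta by rewrite frob_ge0.
  apply: le_trans (frob_stabilized_le sA hb _ (dev _ sA)) _.
    apply: le_trans hk1; rewrite lerD2l ler_wpM2l ?(ltW hc)//.
    by rewrite ler_pXn2r ?nnegrE ?frob_ge0.
  by have := fbar_stabilized_mono (fun x => derive1_fbar_le hk2) re; lra.
have stf n x : sym_tracefree (Q n x).
  case: n => [|n]; first by rewrite hinitQ; apply: hQ0.
  by have [[]] := hstep n.
have node n : forall x, frob (Q n x) <= eta.
  elim: n => [x|n IH]; first by rewrite hinitQ (le_trans (le_q0 _ _)).
  have [[_ bd] step _] := hstep n.
  apply: (implicit_step_bound (ltW hLpos) htau _ k0 eta0 bd step IH).
    by rewrite divr_ge0 ?expR_ge0.
  by move=> x; exact: stab.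
by move=> n; apply: bigmax_le.
Qed.
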